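(* Let $P_0^+, P_1^+, P_2^+, P_0^-, P_1^-, P_2^-$ be finite sets of propositional variables such that, for each $\circ \in \{+,-\}$, the sets $P_0^\circ$, $P_1^\circ$, $P_2^\circ$ are pairwise disjoint. Let $\mathsf{V}_0$ and $\mathsf{V}_1$ be truth assignments. If $\mathsf{V}_0 \xrightarrow[0]{(P_1^+, P_1^-)} \mathsf{V}_1$, then there exists a truth assignment $\mathsf{V}^*$ such that $\mathsf{V}_0 \xrightarrow[0]{(P_0^+ \cup P_1^+,\, P_0^- \cup P_1^-)} \mathsf{V}^*$ and $\mathsf{V}^* \xrightarrow[0]{(P_1^+ \cup P_2^+,\, P_1^- \cup P_2^-)} \mathsf{V}_1$.
   Context: Formulas are classical propositional formulas built from propositional variables, $\bot$, and $\land,\lor,\neg,\to$; truth assignments assign $0/1$ values to all formulas in the usual way. The sets $v^+(\varphi)$, $v^-(\varphi)$ of variables occurring positively/negatively in $\varphi$ are defined by: $v^+(p)=\{p\}$, $v^-(p)=\emptyset$; $v^\circ(\bot)=\emptyset$; $v^\circ(\varphi\ast\psi)=v^\circ(\varphi)\cup v^\circ(\psi)$ for $\ast\in\{\land,\lor\}$; $v^+(\neg\varphi)=v^-(\varphi)$, $v^-(\neg\varphi)=v^+(\varphi)$; $v^+(\varphi\to\psi)=v^-(\varphi)\cup v^+(\psi)$, $v^-(\varphi\to\psi)=v^+(\varphi)\cup v^-(\psi)$. For finite sets $P^+,P^-$ of variables, a $(P^+,P^-)$-formula is a formula $\varphi$ with $v^+(\varphi)\subseteq P^+$ and $v^-(\varphi)\subseteq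 P^-$. For truth assignments $\mathsf{V},\mathsf{V}'$, write $\mathsf{V} \xrightarrow[0]{(P^+,P^-)} \mathsf{V}'$ iff for every $(P^+,P^-)$-formula $\varphi$, $\mathsf{V}(\varphi)=1$ implies $\mathsf{V}'(\varphi)=1$. *)

(* Defs.v *)
From mathcomp Require Import all_boot finmap.
Set Implicit Arguments.
Unset Strict Implicit.
Unset Printing Implicit Defensive.

Local Open Scope fset_scope.

Inductive formula (var : Type) : Type :=
| FVar of var
| FBot
| FAnd of formula var & formula var
| FOr of formula var & formula var
| FNot of formula var
| FImp of formula var & formula var.

Arguments FBot {var}.

(* A truth assignment is given by its values on the variables and extended to
   all formulas by [eval]. *)
Definition assignment (var : Type) := var -> bool.

Fixpoint eval (var : Type) (V : assignment var) (phi : formula var) : bool :=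
  match phi with
  | FVar p => V p
  | FBot => false
  | FAnd a b => eval V a && eval V b
  | FOr a b => eval V a || eval V b
  | FNot a => ~~ eval V a
  | FImp a b => eval V a ==> eval V b
  end.

(* The sign [true] stands for + and [false] for -. *)
Fixpoint occ (var : choiceType) (s : bool) (phi : formula var) : {fset var} :=
  match phi with
  | FVar p => if s then [fset p] else fset0
  | FBot => fset0
  | FAnd a b | FOr a b => occ s a `|` occ s b
  | FNot a => occ (~~ s) a
  | FImp a b => occ (~~ s) a `|` occ s b
  end.

Definition pos_vars (var : choiceType) : formula var -> {fset var} := occ true.
Definition neg_vars (var : choiceType) : formula var -> {fset var} := occ false.

Definition is_PP_formula (var : choiceType) (Pp Pn : {fset var})
    (phi : formula var) : Prop :=
  pos_vars phi `<=` Pp /\ neg_vars phi `<=` Pn.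

Definition transfers (var : choiceType) (Pp Pn : {fset var})
    (V V' : assignment var) : Prop :=
  forall phi : formula var, is_PP_formula Pp Pn phi ->
    eval V phi = true -> eval V' phi = true.

Definition pairwise_disjoint3 (var : choiceType) (A B C : {fset var}) : Prop :=
  [/\ [disjoint A & B], [disjoint A & C] & [disjoint B & C]].

(* Main.v *)
Require Import Defs.
From mathcomp Require Import all_boot finmap.
Local Open Scope fset_scope.

(** Transfer along [(P+, P-)] only has to be tested on literals: it says that
    [V <= V'] on [P+] and [V' <= V] on [P-]. The intermediate assignment must
    therefore lie above [V0] on [P0+ U P1+] and above [V1] on [P1- U P2-]; the
    least such assignment satisfies the two upper bounds as well, because
    [(P0 U P1) n (P1 U P2) = P1] for each sign, where the hypothesis
    compares [V0] and [V1]. *)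

(* Both signs are handled at once, since negation swaps the two assignments. *)
Lemma eval_implies_of_occ (var : choiceType) (phi : formula var)
    (V V' : assignment var) :
  (forall p, p \in occ true phi -> V p -> V' p) ->
  (forall p, p \in occ false phi -> V' p -> V p) ->
  eval V phi -> eval V' phi.
Proof.
elim: phi V V' => [p | | a IHa b IHb | a IHa b IHb | a IHa | a IHa b IHb]
  V V' /= hpos hneg //.
- by apply: hpos; rewrite inE.
- by case/andP=> ea eb; apply/andP; split; [apply: IHa ea | apply: IHb eb];
    move=> p hp; (apply: hpos || apply: hneg); rewrite inE hp ?orbT.
- by case/orP=> e; apply/orP; [left; apply: IHa e | right; apply: IHb e];
    move=> p hp; (apply: hpos || apply: hneg); rewrite inE hp ?orbT.
- by apply: contra; apply: IHa.
- move=> /implyP eab; apply/implyP => ea.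
  (* The premise [a], whose signs are swapped, is pulled back from [V'] to [V]; then [b] is carried
     forward. *)
  apply: (IHb V V') (eab _); last apply: IHa ea;
    by move=> p hp; (apply: hpos || apply: hneg); rewrite inE hp ?orbT.
Qed.

Lemma transfersP (var : choiceType) (Pp Pn : {fset var})
    (V V' : assignment var) :
  transfers Pp Pn V V' <->
  (forall p, p \in Pp -> V p -> V' p) /\ (forall p, p \in Pn -> V' p -> V p).
Proof.
split=> [h | [hpos hneg] phi [/fsubsetP sp /fsubsetP sn]]; last first.
  by apply: eval_implies_of_occ => p hp; [apply/hpos/sp | apply/hneg/sn].
split=> p hp.
  by apply: (h (FVar p)); split; rewrite /pos_vars /neg_vars /= ?fsub1set ?fsub0set.
(* The only occurrence in [FNot (FVar p)] is negative, so [h] carries falsity of [p] from [V] to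
   [V'], the contrapositive of the goal. *)
apply: contraTT; apply: (h (FNot (FVar p))).
by split; rewrite /pos_vars /neg_vars /= ?fsub1set ?fsub0set.
Qed.

Theorem theorem2p3 (var : choiceType)
    (P0p P1p P2p P0n P1n P2n : {fset var})
    (hp : pairwise_disjoint3 P0p P1p P2p)
    (hn : pairwise_disjoint3 P0n P1n P2n)
    (V0 V1 : assignment var)
    (h01 : transfers P1p P1n V0 V1) :
  exists Vs : assignment var,
    transfers (P0p `|` P1p) (P0n `|` P1n) V0 Vs /\
    transfers (P1p `|` P2p) (P1n `|` P2n) Vs V1.
Proof.
have [h1p h1n] := (transfersP _ _ _ _ _).1 h01.
(* For each sign, disjointness of [P0] and [P2] forces a variable lying in both unions into [P1]. *)
have [_ /fdisjointP dp _] := hp; have [_ /fdisjointP dn _] := hn.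
exists (fun p => (p \in P0p `|` P1p) && V0 p || (p \in P1n `|` P2n) && V1 p).
split; apply/transfersP; split=> p hq.
- by rewrite hq => ->.
- case/orP=> /andP[] //; move: hq; rewrite !inE.
  by case/orP=> [/dn/negPf-> /[!orbF]|] q0 q1; apply: h1n.
- case/orP=> /andP[] //; move: hq; rewrite !inE.
  by move=> q2 /orP[/dp/negPf q|]; [move: q2; rewrite q orbF|]; apply: h1p.
- by rewrite hq => ->; rewrite orbT.
Qed.
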